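(* Let $f=(f_1,\dots,f_m):\mathbb{K}^n\to\mathbb{R}^m$, $f_i(x)=x^*A_i x-v_i^*x-x^*v_i$, be a quadratic map, where $\mathbb{K}=\mathbb{R}$ or $\mathbb{C}$, each $A_i$ is a symmetric (if $\mathbb{K}=\mathbb{R}$) or hermitian (if $\mathbb{K}=\mathbb{C}$) $n\times n$ matrix, and $v_i\in\mathbb{K}^n$. Define $$\tilde\varepsilon_{\max}^2=\lim_{\epsilon\to 0^+}\ \min_{c\in\mathcal{C}}\left|\left(c\cdot A-\lambda_{\min}(c\cdot A)+\epsilon\right)^{-1}c\cdot v\right|^2\in[0,+\infty],\qquad \mathcal{C}=\{c\in\mathbb{R}^m:\ |c|^2=1,\ \lambda_{\min}(c\cdot A)\le 0\}.$$ Then for any ball $B_\varepsilon(0)=\{x\in\mathbb{K}^n:|x|^2\le\varepsilon^2\}$ with $\varepsilon^2\le\tilde\varepsilon^2_{\max}$, the image $f(B_\varepsilon(0))$ is strictly convex.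
   Context: $x^*$ denotes the transpose (real case) or hermitian conjugate (complex case). For $c=(c^1,\dots,c^m)\in\mathbb{R}^m$: $c\cdot A=\sum_i c^iA_i$, $c\cdot v=\sum_i c^iv_i$. $\lambda_{\min}(A)$ is the smallest eigenvalue of a symmetric (hermitian) matrix $A$. The sum of a matrix and a number means the number is multiplied by the $n\times n$ identity matrix. $|\cdot|$ is the Euclidean norm. A compact set is strictly convex if it is convex and each supporting hyperplane touches it at exactly one point. *)

(* Defs.v *)
From HB Require Import structures.
From mathcomp Require Import all_boot all_order all_algebra.
From mathcomp Require Import complex.
From mathcomp Require Import all_classical all_reals all_analysis.
Set Implicit Arguments.
Unset Strict Implicit.
Unset Printing Implicit Defensive.
Import Order.TTheory GRing.Theory Num.Theory.
Import numFieldNormedType.Exports.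
Local Open Scope classical_set_scope.
Local Open Scope ring_scope.

(* The case split K = R or K = C. Only the two instances built by [scalars]
   below occur in the statement, so the record needs no axioms. *)
Variant scalar_case := RealScalars | ComplexScalars.

Record scalar_field (R : realType) := ScalarField {
  scalar_type :> numFieldType;
  of_real : R -> scalar_type;
  real_part : scalar_type -> R;
  conj_scalar : scalar_type -> scalar_type }.

Definition scalars (R : realType) (k : scalar_case) : scalar_field R :=
  match k with
  | RealScalars => @ScalarField R R id id id
  | ComplexScalars =>
      @ScalarField R R[i]%C (fun x => x%:C%C) (@complex.Re R) (@conjc R)
  end.

Section Vectors.
Variables (R : realType) (m : nat).
Implicit Types c y : 'rV[R]_m.

Definition dotv c y : R := \sum_i c 0 i * y 0 i.

(* The supporting hyperplanes of S are the sets {y | c.y = h} with c <> 0 that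
   meet S and have S on one side; replacing (c, h) by (- c, - h) covers the
   other orientation. *)
Definition supporting_hyperplane (S : set 'rV[R]_m) c (h : R) :=
  [/\ c != 0, forall y, S y -> h <= dotv c y & exists2 y, S y & dotv c y = h].

Definition strictly_convex (S : set 'rV[R]_m) :=
  [/\ compact S,
      convex_set S &
      forall c h, supporting_hyperplane S c h ->
        exists! y, S y /\ dotv c y = h].

End Vectors.

Section QuadraticMap.
Variables (R : realType) (K : scalar_field R) (m n : nat).

Definition adjoint (p q : nat) (B : 'M[K]_(p, q)) : 'M[K]_(q, p) :=
  (map_mx (@conj_scalar R K) B)^T.

Definition is_hermitian (B : 'M[K]_n) := adjoint B = B.

Definition sqnorm (x : 'cV[K]_n) : R := \sum_i real_part `|x i 0| ^+ 2.

(* The infimum is a minimum when B is hermitian and 0 < n: the eigenvalues are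
   then real, and they form a finite nonempty set. [eigenvalue] is about row
   eigenvectors, which have the same eigenvalues as column eigenvectors. *)
Definition lambda_min (B : 'M[K]_n) : R :=
  inf [set a : R | eigenvalue B (of_real K a)].

Variables (A : 'I_m -> 'M[K]_n) (v : 'I_m -> 'cV[K]_n).

(* For hermitian [A i] the expression is fixed by conjugation, so taking the
   real part only changes its type. *)
Definition quadratic_map (x : 'cV[K]_n) : 'rV[R]_m :=
  \row_i real_part ((adjoint x *m A i *m x
                     - adjoint (v i) *m x - adjoint x *m v i) 0 0).

Definition comb_mx (c : 'rV[R]_m) : 'M[K]_n := \sum_i of_real K (c 0 i) *: A i.

Definition comb_vec (c : 'rV[R]_m) : 'cV[K]_n := \sum_i of_real K (c 0 i) *: v i.

(* For hermitian [A i] and e > 0 the matrix under [invmx] is positive definite,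
   hence invertible. *)
Definition resolvent_sqnorm (e : R) (c : 'rV[R]_m) : R :=
  let B := comb_mx c in
  sqnorm (invmx (B - (of_real K (lambda_min B))%:M + (of_real K e)%:M)
          *m comb_vec c).

Definition nonpos_directions : set 'rV[R]_m :=
  [set c | dotv c c = 1 /\ lambda_min (comb_mx c) <= 0].

(* For hermitian [A i] and 0 < m, 0 < n the infimum is attained for each e > 0
   (a continuous function on a nonempty compact set), and it is nonincreasing
   in e, so that the limit exists in [0, +oo]. *)
Definition eps_max_sq : \bar R :=
  lim (ereal_inf [set (resolvent_sqnorm e c)%:E | c in nonpos_directions]
       @[e --> 0^'+]).

Definition origin_ball (eps : R) : set 'cV[K]_n :=
  [set x | sqnorm x <= eps ^+ 2].

End QuadraticMap.

Arguments origin_ball {R} K n eps.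

(* Main.v *)
(* Identify K^n with a real Euclidean space. For a unit direction c write
   q = c.f, B = c.A, b = c.v, M = B - lambda_min(B), so that
   q(x) = p(x) + lambda_min(B) |x|^2 with p convex.

   The minimiser of q on |x| <= t, for 0 < t <= eps, is unique. This is strict
   convexity of q if lambda_min(B) > 0. Otherwise, a minimiser x0 of p on the
   ball satisfies (M + mu) x0 = b with mu >= 0, and mu > 0 only if |x0| = t.
   If mu = 0 then x0 solves M x0 = b; every such solution is at least as long as
   (M + e)^-1 b for all e > 0, hence has length >= eps >= t. So |x0| = t
   and q(x) - q(x0) = (x - x0)*(M + mu)(x - x0) + (lambda_min(B) - mu)(|x|^2 - t^2)
   is a sum of nonnegative terms. Equality forces x = x0 if mu > 0, and M x = b if
   mu = 0, a convex set which meets the ball only in its boundary sphere.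

   Convexity of the image follows without any degree theory: for y in the convex
   hull of f(B_eps), shrink the ball to the least radius t for which y satisfies
   min_{B_t} c.f <= c.y for all c. At that radius some c is tight, and
   differentiating in c at the unique minimiser x gives f(x) = y. *)
Require Import Defs.
From HB Require Import structures.
From mathcomp Require Import all_boot all_order all_algebra.
From mathcomp Require Import complex.
From mathcomp Require Import all_classical all_reals all_analysis.
From mathcomp Require Import ring lra.
Set Implicit Arguments.
Unset Strict Implicit.
Unset Printing Implicit Defensive.
Import Order.TTheory GRing.Theory Num.Theory.
Import numFieldNormedType.Exports.
Local Open Scope classical_set_scope.
Local Open Scope ring_scope.

(** * Euclidean geometry of row vectors: dot product, positive semidefinite forms, compactness *)

Section DotProduct.
Variables (R : realType) (N : nat).
Implicit Types (x y z w : 'rV[R]_N) (a : R) (S : 'M[R]_N).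

Lemma dotvC x y : dotv x y = dotv y x.
Proof. by apply: eq_bigr => i _; rewrite mulrC. Qed.

Lemma dotvDl x y z : dotv (x + y) z = dotv x z + dotv y z.
Proof. by rewrite -big_split; apply: eq_bigr => i _; rewrite mxE mulrDl. Qed.

Lemma dotvZl a x z : dotv (a *: x) z = a * dotv x z.
Proof. by rewrite mulr_sumr; apply: eq_bigr => i _; rewrite mxE mulrA. Qed.

Lemma dotvNl x z : dotv (- x) z = - dotv x z.
Proof. by rewrite -scaleN1r dotvZl mulN1r. Qed.

Lemma dotvDr x y z : dotv z (x + y) = dotv z x + dotv z y.
Proof. by rewrite !(dotvC z) dotvDl. Qed.

Lemma dotvZr a x z : dotv z (a *: x) = a * dotv z x.
Proof. by rewrite !(dotvC z) dotvZl. Qed.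

Lemma dotvNr x z : dotv z (- x) = - dotv z x.
Proof. by rewrite !(dotvC z) dotvNl. Qed.

Definition dotvE := (dotvDl, dotvDr, dotvNl, dotvNr, dotvZl, dotvZr).

Lemma dotv0l z : dotv 0 z = 0.
Proof. by rewrite -(scale0r 0) dotvZl mul0r. Qed.

Lemma dotv_suml (I : finType) (F : I -> 'rV[R]_N) z :
  dotv (\sum_i F i) z = \sum_i dotv (F i) z.
Proof. exact: (big_morph _ (fun x y => dotvDl x y z) (dotv0l z)). Qed.

Lemma dotvv_ge0 x : 0 <= dotv x x.
Proof. by apply: sumr_ge0 => i _; exact: sqr_ge0. Qed.

Lemma dotvv_eq0 x : (dotv x x == 0) = (x == 0).
Proof.
apply/idP/idP => [|/eqP->]; last by rewrite dotv0l.
rewrite psumr_eq0 => [/allP x0|i _]; last exact: sqr_ge0.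
apply/eqP/rowP => i; rewrite mxE.
by have := x0 i (mem_index_enum _); rewrite -expr2 sqrf_eq0 => /eqP.
Qed.

Lemma dotvv_gt0 x : (0 < dotv x x) = (x != 0).
Proof. by rewrite lt0r dotvv_ge0 andbT dotvv_eq0. Qed.

Lemma dotvv_unit x : x != 0 ->
  dotv ((Num.sqrt (dotv x x))^-1 *: x) ((Num.sqrt (dotv x x))^-1 *: x) = 1.
Proof.
rewrite -dotvv_gt0 => x0; rewrite !dotvE mulrA -expr2 exprVn sqr_sqrtr ?ltW//.
by rewrite mulVf ?gt_eqF.
Qed.

Lemma dotv_mulmx S x y : dotv (x *m S) y = dotv x (y *m S^T).
Proof.
have dE (u w : 'rV[R]_N) : dotv u w = (u *m w^T) 0 0.
  by rewrite mxE; apply: eq_bigr => i _; rewrite mxE.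
by rewrite !dE trmx_mul trmxK mulmxA.
Qed.

(** With g = xS and b = gS.g, the form takes the value -2s|g|^2 + s^2 b at x - s g, which is
    negative for small s > 0 unless g = 0. The choice s = |g|^2 / (b + 1) turns this value into -s^2
    (b + 2). *)
Lemma psd_mulmx_eq0 S x : S^T = S -> (forall y, 0 <= dotv (y *m S) y) ->
  dotv (x *m S) x = 0 -> x *m S = 0.
Proof.
move=> Ssym Spsd xSx; pose g := x *m S; apply/eqP; rewrite -dotvv_eq0 -/g.
pose a := dotv g g; pose b := dotv (g *m S) g; pose s := a / (b + 1).
have b0 : 0 <= b by exact: Spsd.
have := Spsd (x - s *: g).
rewrite mulmxBl -scalemxAl !dotvE xSx [dotv (g *m S) x]dotv_mulmx Ssym -/g -/a -/b.
have aE : a = s * (b + 1) by rewrite divfK// gt_eqF// ltr_wpDl.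
rewrite aE => h; have {h} : s ^+ 2 * (b + 2) <= 0 by nra.
rewrite pmulr_lle0 ?ltr_wpDl// => s0; have /eqP : s ^+ 2 = 0.
  by apply/le_anti; rewrite s0 sqr_ge0.
by rewrite sqrf_eq0 => /eqP ->; rewrite mul0r.
Qed.

Lemma cauchy_schwarz x y : dotv x y ^+ 2 <= dotv x x * dotv y y.
Proof.
have := dotvv_ge0 (dotv y y *: x - dotv x y *: y).
rewrite !dotvE (dotvC y x) => h.
have [->|y0] := eqVneq y 0; first by rewrite dotvC !dotv0l mulr0 expr0n.
rewrite -subr_ge0 -(@pmulr_rge0 _ (dotv y y)) ?dotvv_gt0//.
by apply: le_trans h _; rewrite le_eqVlt; apply/orP; left; apply/eqP; ring.
Qed.

Lemma continuous_dotv (T : topologicalType) (f g : T -> 'rV[R]_N) :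
  continuous f -> continuous g -> continuous (fun t => dotv (f t) (g t)).
Proof.
move=> cf cg; apply: continuous_big => [|i _ t]; first exact: add_continuous.
apply: cvgM; apply: (@continuous_comp _ _ _ _ (fun x : 'rV[R]_N => x 0 i));
  by [exact: cf|exact: cg|exact: coord_continuous].
Qed.

Lemma compact_le_dotv (r : R) : compact [set x : 'rV[R]_N | dotv x x <= r].
Proof.
(* The half-side |r| + 1 bounds each coordinate, since a^2 <= r implies |a| <= |r| + 1. *)
have r0 : compact [set x : 'rV[R]_N |
    forall i, x ord0 i \in `[(- (`|r| + 1)), (`|r| + 1)]].
  apply: (@rV_compact _ _ (fun=> `[(- (`|r| + 1)), (`|r| + 1)]%classic)).
  by move=> _; apply: segment_compact.
apply: subclosed_compact r0 _ => [|x /= xr i].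
  apply: (@closed_comp _ _ (fun x : 'rV[R]_N => dotv x x) [set a | a <= r]).
    by move=> x _; apply: continuous_dotv => ?; exact: cvg_id.
  exact: closed_le.
have xi : x ord0 i ^+ 2 <= dotv x x.
  rewrite /dotv (bigD1 i)//= -expr2 lerDl.
  by apply: sumr_ge0 => j _; exact: sqr_ge0.
have rr := ler_norm r; rewrite in_itv/=; apply/andP; split; nra.
Qed.

Lemma compact_unit_sphere : compact [set x : 'rV[R]_N | dotv x x = 1].
Proof.
apply: subclosed_compact (compact_le_dotv (r := 1)) _ => [|x /= ->]; last by [].
apply: (@closed_comp _ _ (fun x : 'rV[R]_N => dotv x x) [set a | a = 1]).
  by move=> x _; apply: continuous_dotv => ?; exact: cvg_id.
exact: closed_eq.
Qed.

Lemma continuous_mulmxr p (S : 'M[R]_(N, p)) : continuous (fun x => x *m S).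
Proof.
under eq_fun do rewrite mulmx_sum_row.
apply: continuous_big => [|i _ x]; first exact: add_continuous.
by apply: (cvgZr_tmp (FF := nbhs_filter x)); exact: coord_continuous.
Qed.

End DotProduct.

(** * Minimisation of a quadratic function on a Euclidean ball *)

Section TrustRegion.
Variables (R : realType) (N : nat).
Implicit Types (x y z w : 'rV[R]_N) (S : 'M[R]_N).

(** The squared norm of the point is (1 - s)|x|^2 + s|y|^2 - s(1 - s)|x - y|^2. *)
Lemma dotvv_seg_le x y (s r : R) : 0 <= s <= 1 ->
  dotv x x <= r -> dotv y y <= r ->
  dotv (x + s *: (y - x)) (x + s *: (y - x)) <= r.
Proof.
move=> /andP[s0 s1] xr yr; have := dotvv_ge0 (x - y).
rewrite !dotvE (dotvC y x) => h.
have sh : 0 <= s * (1 - s) by rewrite mulr_ge0 ?subr_ge0.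
have := mulr_ge0 sh h; nra.
Qed.

(** [lam] is the minimum of the form on the unit sphere. The form of S - lam is then nonnegative and
    vanishes at the minimiser, which [psd_mulmx_eq0] turns into an eigenvector. *)
Lemma rayleigh_min S : (0 < N)%N -> S^T = S ->
  exists2 lam, (forall x, lam * dotv x x <= dotv (x *m S) x) &
    exists2 x : 'rV[R]_N, x != 0 & x *m S = lam *: x.
Proof.
move=> N0 Ssym.
have /compact_EVT_min : [set x : 'rV[R]_N | dotv x x = 1] !=set0.
  have e0 : (delta_mx 0 (Ordinal N0) : 'rV[R]_N) != 0.
    apply/eqP => /rowP/(_ (Ordinal N0)); rewrite !mxE !eqxx/= => /eqP.
    by rewrite oner_eq0.
  by exists ((Num.sqrt (dotv (delta_mx 0 (Ordinal N0)) (delta_mx 0 (Ordinal N0))))^-1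
    *: (delta_mx 0 (Ordinal N0) : 'rV[R]_N)); exact: dotvv_unit.
move=> /(_ R (fun x => dotv (x *m S) x) (@compact_unit_sphere R N)).
case=> [|x0]; first (apply: continuous_subspaceT; apply: continuous_dotv;
  by [exact: continuous_mulmxr|move=> ?; exact: cvg_id]).
rewrite inE/= => x01 x0min.
have lamP x : dotv (x0 *m S) x0 * dotv x x <= dotv (x *m S) x.
  have [->|xn0] := eqVneq x 0; first by rewrite mul0mx !dotv0l mulr0.
  have := x0min _ (mem_set (dotvv_unit xn0)).
  rewrite -scalemxAl dotvZl dotvZr mulrA -expr2 exprVn sqr_sqrtr ?dotvv_ge0//.
  by rewrite mulrC ler_pdivlMr ?dotvv_gt0.
exists (dotv (x0 *m S) x0) => //; exists x0.
  by rewrite -dotvv_eq0 x01 oner_eq0.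
set lam := dotv _ _; have : x0 *m (S - lam%:M) = 0.
  apply: psd_mulmx_eq0 => [|y|]; first by rewrite linearB/= Ssym tr_scalar_mx.
    by rewrite mulmxBr mul_mx_scalar !dotvE subr_ge0 lamP.
  by rewrite mulmxBr mul_mx_scalar !dotvE x01 mulr1 subrr.
by rewrite mulmxBr mul_mx_scalar => /subr0_eq.
Qed.

(** Since (y - x)S = -d y, nonnegativity at y - x gives |y|^2 <= x.y, and 2 x.y <= |x|^2 + |y|^2.
    This serves both to compare solutions of xM = w with resolvents and to show that resolvents
    shrink as the shift grows. *)
Lemma resolvent_contraction S (d : R) x y :
  (forall z, 0 <= dotv (z *m S) z) -> 0 < d ->
  y *m S + d *: y = x *m S -> dotv y y <= dotv x x.
Proof.
move=> Spsd d0 yx.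
have zS : (y - x) *m S = - d *: y by rewrite mulmxBl -yx opprD addNKr scaleNr.
have := Spsd (y - x); have := dotvv_ge0 (x - y).
rewrite zS !dotvE (dotvC y x) => h1 h2.
by have : dotv y y <= dotv x y; nra.
Qed.

(** The real form of x^*Bx - u^*x - x^*u; the factor 2 appears because the two linear terms have the
    same real part. *)
Definition quad S w x := dotv (x *m S) x - 2 * dotv w x.

Lemma continuous_quad S w : continuous (quad S w).
Proof.
move=> x; have cid : continuous (@id 'rV[R]_N) by move=> ?; exact: cvg_id.
have cw : continuous (fun _ : 'rV[R]_N => w) by exact: cst_continuous.
have cS : continuous (fun z => z *m S) by exact: continuous_mulmxr.
have c1 : continuous (fun z => dotv (z *m S) z) := continuous_dotv cS cid.
have c2 : continuous (dotv w) := continuous_dotv cw cid.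
apply: (cvgB (FF := nbhs_filter x)); first exact: c1.
by apply: (cvgM (FF := nbhs_filter x)); [exact: cvg_cst|exact: c2].
Qed.

Lemma quad_shift S w x h : S^T = S ->
  quad S w (x + h) = quad S w x + 2 * dotv (x *m S - w) h + dotv (h *m S) h.
Proof.
move=> Ssym; rewrite /quad mulmxDl !dotvE.
have -> : dotv (h *m S) x = dotv (x *m S) h by rewrite dotv_mulmx Ssym dotvC.
ring.
Qed.

(** These are the Karush-Kuhn-Tucker conditions at a minimiser [x0] of [quad S w] on the ball. With
    half-gradient g, either g = 0, or [x0] minimises the linear form g on the ball, hence is the
    boundary point opposite to g. *)
Lemma psd_ball_multiplier S w (r : R) : S^T = S ->
  (forall z, 0 <= dotv (z *m S) z) -> 0 < r ->
  exists x mu, [/\ 0 <= mu, dotv x x <= r ^+ 2, x *m S + mu *: x = w &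
    mu = 0 \/ dotv x x = r ^+ 2].
Proof.
move=> Ssym Spsd r0.
have /compact_EVT_min : [set x : 'rV[R]_N | dotv x x <= r ^+ 2] !=set0.
  by exists 0; rewrite /= dotv0l sqr_ge0.
move=> /(_ R (quad S w) (@compact_le_dotv R N (r ^+ 2))).
case=> [|x0]; first by apply: continuous_subspaceT; exact: continuous_quad.
rewrite inE/= => x0r x0min; have [g gE] : exists g, g = x0 *m S - w by eexists.
have var x : dotv x x <= r ^+ 2 -> 0 <= dotv g (x - x0).
  move=> xr; set h := x - x0; rewrite leNgt; apply/negP => gh.
  pose b := dotv (h *m S) h; have b0 : 0 <= b by exact: Spsd.
  (* Moving by s h changes the value by 2s g.h + s^2 b, which for this s in (0, 1] equals s(1 + s)
     g.h < 0. *)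
  pose s := - dotv g h / (b - dotv g h).
  have bgh : 0 < b - dotv g h by lra.
  have sE : s * (b - dotv g h) = - dotv g h by rewrite /s divfK ?gt_eqF.
  have s0 : 0 < s by rewrite divr_gt0// oppr_gt0.
  have s1 : s <= 1 by rewrite ler_pdivrMr//; lra.
  have sr : dotv (x0 + s *: h) (x0 + s *: h) <= r ^+ 2.
    by apply: dotvv_seg_le; rewrite ?(ltW s0).
  have := x0min _ (mem_set sr); clearbody h.
  rewrite quad_shift// -gE -scalemxAl !dotvE -/b.
  have -> : s * b = - dotv g h + s * dotv g h by rewrite -sE; ring.
  have : s * (1 + s) * dotv g h < 0 by rewrite pmulr_rlt0// mulr_gt0// addr_gt0.
  lra.
have [g0|gn0] := eqVneq g 0.
  exists x0, 0; split => //; last by left.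
  by rewrite scale0r addr0; by apply: subr0_eq; rewrite -gE.
pose k := Num.sqrt (dotv g g).
have k2 : k ^+ 2 = dotv g g by rewrite sqr_sqrtr ?dotvv_ge0.
have k0 : 0 < k by rewrite sqrtr_gt0 dotvv_gt0.
(* Test the first-order inequality at the boundary point -(r/k) g. Cauchy-Schwarz then forces |x0| =
   r. *)
have gx0 : dotv g x0 <= - (r * k).
  have := var (- (r / k) *: g); rewrite !dotvE -k2.
  have -> : - (r / k) * (- (r / k) * k ^+ 2) = r ^+ 2 by field; rewrite gt_eqF.
  have -> : - (r / k) * k ^+ 2 = - (r * k) by field; rewrite gt_eqF.
  by move=> /(_ (lexx _)); lra.
have x0E : dotv x0 x0 = r ^+ 2.
  apply/le_anti; rewrite x0r/= -(@ler_pM2l _ (k ^+ 2)) ?exprn_gt0//.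
  rewrite k2; apply: le_trans (cauchy_schwarz g x0); rewrite -k2.
  have : 0 < r * k by exact: mulr_gt0.
  nra.
exists x0, (k / r); split => //; [by rewrite ltW// divr_gt0| |by right].
(* Equality case of Cauchy-Schwarz: the square expands to at most k^2 - 2k^2 + k^2. *)
have : dotv (g + (k / r) *: x0) (g + (k / r) *: x0) <= 0.
  rewrite !dotvE (dotvC x0 g) x0E -k2.
  have -> : k / r * (k / r * r ^+ 2) = k ^+ 2 by field; rewrite gt_eqF.
  have kr : (k / r) * dotv g x0 <= (k / r) * - (r * k).
    by rewrite ler_wpM2l// ltW// divr_gt0.
  have krE : (k / r) * - (r * k) = - k ^+ 2 by field; rewrite gt_eqF.
  lra.
rewrite le_eqVlt ltNge dotvv_ge0 orbF dotvv_eq0 gE addrAC => /eqP.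
by move=> /subr0_eq.
Qed.

(** The hypothesis for lam <= 0 replaces the limit defining the critical radius: resolvent vectors
    (M + e)^-1 w, with M = S - lam, come with squared length above any s < r^2. *)
Lemma quad_ball_argmin_unique S w (lam r : R) x1 x2 : S^T = S ->
  (forall z, lam * dotv z z <= dotv (z *m S) z) -> 0 < r ->
  (lam <= 0 -> forall s, s < r ^+ 2 -> exists (e : R) x,
    [/\ 0 < e, x *m S - lam *: x + e *: x = w & s < dotv x x]) ->
  dotv x1 x1 <= r ^+ 2 -> dotv x2 x2 <= r ^+ 2 ->
  (forall x, dotv x x <= r ^+ 2 -> quad S w x1 <= quad S w x) ->
  (forall x, dotv x x <= r ^+ 2 -> quad S w x2 <= quad S w x) ->
  x1 = x2.
Proof.
move=> Ssym lamP r0 res x1r x2r x1min x2min.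
have half : 0 <= (2^-1 : R) <= 1 by apply/andP; split; lra.
apply/eqP; rewrite eq_sym -subr_eq0 -dotvv_eq0; apply/eqP/le_anti.
rewrite dotvv_ge0 andbT; have [lam0|lam0] := ltP 0 lam.
  (* Strictly convex case: minimality at the midpoint and at both ends gives hS.h <= 0 for h = x2 -
     x1. *)
  have := x1min _ (dotvv_seg_le half x1r x2r).
  have := x2min _ x1r; have := lamP (x2 - x1).
  rewrite -[X in quad S w X <= _](subrK x1) (addrC _ x1).
  have := dotvv_ge0 (x2 - x1).
  move: (x2 - x1) => h; rewrite !quad_shift// -scalemxAl !dotvE; nra.
pose M := S - lam%:M.
have xM x : x *m M = x *m S - lam *: x by rewrite mulmxBr mul_mx_scalar.
have Msym : M^T = M by rewrite linearB/= Ssym tr_scalar_mx.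
have Mpsd z : 0 <= dotv (z *m M) z by rewrite xM !dotvE subr_ge0.
(* A shorter solution z would be shorter than some resolvent vector, against
   [resolvent_contraction]. *)
have sol_ge z : z *m M = w -> r ^+ 2 <= dotv z z.
  move=> zw; rewrite leNgt; apply/negP => /(res lam0)[e [x [e0 xw]]].
  by apply/negP; rewrite -leNgt (resolvent_contraction Mpsd e0)// xM xw zw.
have [x0 [mu [mu0 x0r x0w x0mu]]] := psd_ball_multiplier w Msym Mpsd r0.
have x0E : dotv x0 x0 = r ^+ 2.
  case: x0mu => // mu00; apply/le_anti; rewrite x0r/= sol_ge//.
  by rewrite -x0w mu00 scale0r addr0.
have gap x : quad S w x = quad S w x0 + dotv ((x - x0) *m M) (x - x0)
    + mu * dotv (x - x0) (x - x0) + (lam - mu) * (dotv x x - r ^+ 2).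
  rewrite -{1}(subrK x0 x) (addrC _ x0) quad_shift// -x0E.
  have -> : x0 *m S - w = (lam - mu) *: x0.
    rewrite -x0w xM; move: (x0 *m S) => u.
    by apply/rowP => i; rewrite !mxE; ring.
  by rewrite !xM !dotvE (dotvC x0 x); ring.
have argmin x : dotv x x <= r ^+ 2 ->
    (forall z, dotv z z <= r ^+ 2 -> quad S w x <= quad S w z) ->
    dotv ((x - x0) *m M) (x - x0) = 0 /\ mu * dotv (x - x0) (x - x0) = 0.
  move=> xr /(_ _ x0r); rewrite gap => h.
  have a0 := Mpsd (x - x0).
  have b0 : 0 <= mu * dotv (x - x0) (x - x0) by rewrite mulr_ge0 ?dotvv_ge0.
  have c0 : 0 <= (lam - mu) * (dotv x x - r ^+ 2) by nra.
  lra.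
have [A1 B1] := argmin _ x1r x1min; have [A2 B2] := argmin _ x2r x2min.
have [mu00|mun0] := eqVneq mu 0; last first.
  have eq0 x : mu * dotv (x - x0) (x - x0) = 0 -> x = x0.
    by move=> /eqP; rewrite mulf_eq0 (negbTE mun0) dotvv_eq0 => /eqP/subr0_eq.
  by rewrite (eq0 x1)// (eq0 x2)// subrr dotv0l.
have solM x : dotv ((x - x0) *m M) (x - x0) = 0 -> x *m M = w.
  move=> /(psd_mulmx_eq0 Msym Mpsd); rewrite mulmxBl => /subr0_eq ->.
  by rewrite -x0w mu00 scale0r addr0.
have x1M := solM _ A1; have x2M := solM _ A2.
(* The midpoint is again a solution, so its squared length is at least r^2, while the parallelogram
   identity bounds it by r^2 - |x2 - x1|^2 / 4. *)
have /sol_ge : (x1 + 2^-1 *: (x2 - x1)) *m M = w.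
  by rewrite mulmxDl -scalemxAl mulmxBl x1M x2M subrr scaler0 addr0.
by rewrite !dotvE (dotvC x2 x1); lra.
Qed.

End TrustRegion.

(** * Strict convexity of the image of a ball from uniqueness of minimisers *)

Section ImageConvexity.
Variables (R : realType) (N m : nat) (f : 'rV[R]_N -> 'rV[R]_m).
Hypothesis cf : continuous f.
Implicit Types (x z : 'rV[R]_N) (c y d : 'rV[R]_m) (r s t : R).

Let B t := [set x : 'rV[R]_N | dotv x x <= t ^+ 2].

Lemma dotvv_scaler_le x s t : 0 <= t -> dotv x x <= s ^+ 2 ->
  dotv (t *: x) (t *: x) <= (t * s) ^+ 2.
Proof. by move=> t0 xs; rewrite !dotvE mulrA -expr2 exprMn ler_wpM2l ?sqr_ge0. Qed.

(** Writing all balls as multiples of the unit ball lets the radius vary over a fixed compact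
    set. *)
Lemma ball_scaled x t : 0 <= t -> B t x -> exists2 z, B 1 z & x = t *: z.
Proof.
rewrite /B/= expr1n => t0 xt; have [tE|tn0] := eqVneq t 0.
  move: xt; rewrite tE expr0n/= le_eqVlt ltNge dotvv_ge0 orbF dotvv_eq0.
  by move=> /eqP ->; exists 0; rewrite ?dotv0l ?ler01 ?scaler0.
exists (t^-1 *: x); last by rewrite scalerA divff// scale1r.
rewrite !dotvE mulrA -expr2 exprVn mulrC ler_pdivrMr ?mul1r//.
by rewrite exprn_gt0// lt0r tn0.
Qed.

Lemma eq_of_dotv_unit_le0 y : (forall c, dotv c c = 1 -> dotv c y <= 0) -> y = 0.
Proof.
move=> h; apply/eqP/negPn/negP => y0; have := h _ (dotvv_unit y0).
rewrite dotvZl leNgt pmulr_rgt0 ?dotvv_gt0 ?y0//.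
by rewrite invr_gt0 sqrtr_gt0 dotvv_gt0.
Qed.

Lemma near_dotv_gt0 (T : topologicalType) (g h : T -> 'rV[R]_m) (p : T) :
  continuous g -> continuous h -> 0 < dotv (g p) (h p) ->
  \forall q \near p, 0 < dotv (g q) (h q).
Proof.
move=> cg ch p0; have cgh : continuous (fun q => dotv (g q) (h q)).
  exact: continuous_dotv.
exact: (cgh p _ (lt_nbhsr p0)).
Qed.

(* The last hypothesis says that [y] satisfies all the linear inequalities
   defining the convex hull of f(B_r). *)
Lemma ball_image_surj r y : 0 <= r ->
  (forall t c x1 x2, 0 < t <= r -> dotv c c = 1 -> B t x1 -> B t x2 ->
    (forall x, B t x -> dotv c (f x1) <= dotv c (f x)) ->
    (forall x, B t x -> dotv c (f x2) <= dotv c (f x)) -> x1 = x2) ->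
  (forall c, dotv c c = 1 -> exists2 x, B r x & dotv c (f x - y) <= 0) ->
  exists2 x, B r x & f x = y.
Proof.
move=> r0 uniq hull.
(* The radii at which [y] passes every linear test; their infimum [t] is the least radius to which
   the ball can shrink. *)
pose W := [set t | 0 <= t /\
  forall c, dotv c c = 1 -> exists2 x, B t x & dotv c (f x - y) <= 0].
have W0 : has_inf W by split; [exists r|exists 0 => t []].
pose t := inf W.
have t0 : 0 <= t by apply: lb_le_inf; [exists r|move=> s []].
have tr : t <= r by apply: ge_inf; [exact: W0.2|].
have incl x : B t x -> B r x.
  by move=> /le_trans; apply; rewrite ler_pXn2r ?nnegrE.
have cfs : continuous (fun p : 'rV[R]_N * R => f (p.2 *: p.1) - y).
  move=> p; apply: (cvgB (FF := nbhs_filter p)); last exact: cvg_cst.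
  apply: (@continuous_comp _ _ _ (fun q : 'rV[R]_N * R => q.2 *: q.1) f).
    by apply: (cvgZ (FF := nbhs_filter p)); [exact: cvg_snd|exact: cvg_fst].
  exact: cf.
(* The infimum is attained: a direction failing at [t] would, by compactness of the unit ball, fail
   at all radii near [t], some of which lie in [W]. *)
have tW c : dotv c c = 1 -> exists2 x, B t x & dotv c (f x - y) <= 0.
  move=> c1; apply: contrapT => nW.
  have pos x : B t x -> 0 < dotv c (f x - y).
    by move=> xt; rewrite ltNge; apply/negP => ?; apply: nW; exists x.
  have := @compact_le_dotv R N (1 ^+ 2).
  move=> /compact_near_coveringP/(_ R (nbhs t)
    (fun s z => 0 < dotv c (f (s *: z) - y)) _).
  case=> [z z1|e /= e0 He].
    apply: (near_dotv_gt0 (T := ('rV[R]_N * R)%type) (p := (z, t))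
      (g := fun=> c) (h := fun p => f (p.2 *: p.1) - y)) => //.
      exact: cst_continuous.
    by apply/pos; have := dotvv_scaler_le t0 z1; rewrite mulr1.
  have [s sW st] := inf_adherent e0 W0.
  have [z z1 xE] : exists2 z, B 1 z & dotv c (f (s *: z) - y) <= 0.
    case: sW => s0 /(_ c c1)[x xs xle].
    by have [z z1 xE] := ball_scaled s0 xs; exists z => //; rewrite -xE.
  have /He/(_ z z1) : ball_ [eta Num.norm] t e s.
    rewrite /= distrC ger0_norm ?subr_ge0 ?ltrBlDl//.
    by apply: ge_inf; [exact: W0.2|exact: sW].
  by rewrite ltNge xE.
have [tE|tn0] := eqVneq t 0.
  exists 0; first by rewrite /B/= dotv0l sqr_ge0.
  apply: subr0_eq; apply: eq_of_dotv_unit_le0 => c /tW[x].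
  rewrite /B/= tE expr0n/= le_eqVlt ltNge dotvv_ge0 orbF dotvv_eq0.
  by move=> /eqP ->.
have tgt0 : 0 < t by rewrite lt0r tn0.
(* A tight direction. Without one, every c has a point with c.(f x - y) < 0. This persists for
   nearby directions and scalings, so compactness of the sphere puts some s t with s < 1 in [W]. *)
have [c c1 cpos] : exists2 c, dotv c c = 1 &
    forall x, B t x -> 0 <= dotv c (f x - y).
  apply: contrapT => nc.
  have neg c : dotv c c = 1 -> exists2 x, B t x & 0 < dotv (- c) (f x - y).
    move=> c1; apply: contrapT => nx; apply: nc; exists c => // x xt.
    rewrite leNgt; apply/negP => x0; apply: nx; exists x => //.
    by rewrite dotvNl oppr_gt0.
  have := @compact_unit_sphere R m.
  move=> /compact_near_coveringP/(_ R (nbhs (1 : R))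
    (fun s c => exists2 x, B t x & 0 < dotv (- c) (f (s *: x) - y)) _).
  case=> [c /neg[x xt xpos]|e /= e0 He].
    have : \forall p \near (c, 1 : R), 0 < dotv (- p.1) (f (p.2 *: x) - y).
      apply: (near_dotv_gt0 (T := ('rV[R]_m * R)%type) (p := (c, 1 : R))
        (g := fun p => - p.1) (h := fun p => f (p.2 *: x) - y)).
      - by move=> p; apply: (cvgN (FF := nbhs_filter p)); exact: cvg_fst.
      - move=> p; apply: (cvgB (FF := nbhs_filter p)); last exact: cvg_cst.
        apply: (@continuous_comp _ _ _ (fun q : 'rV[R]_m * R => q.2 *: x) f).
          by apply: (cvgZr_tmp (FF := nbhs_filter p)); exact: cvg_snd.
        exact: cf.
      - by rewrite /= scale1r.
    by apply: filterS => p ppos; exists x.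
  (* Within e of 1, below 1, and nonnegative thanks to the cap at 1. *)
  pose s := 1 - Num.min e 1 / 2.
  have e1 : 0 < Num.min e 1 by rewrite lt_min e0 ltr01.
  have ee : Num.min e 1 <= e by rewrite ge_min lexx.
  have e2 : Num.min e 1 <= 1 by rewrite ge_min lexx orbT.
  have s0 : 0 <= s by rewrite /s; lra.
  have s1 : s < 1 by rewrite /s; lra.
  have /He{}He : ball_ [eta Num.norm] 1 e s.
    by rewrite /= ger0_norm /s; lra.
  have : t <= s * t.
    apply: ge_inf; first exact: W0.2.
    split; first exact: mulr_ge0.
    move=> c /He[x xt xpos]; exists (s *: x); first exact: dotvv_scaler_le.
    by rewrite ltW// -oppr_gt0 -dotvNl.
  by rewrite leNgt gtr_pMl ?s1.
have [x0 x0t x0le] := tW c c1.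
have x0E : dotv c (f x0 - y) = 0 by apply/le_anti; rewrite x0le cpos.
have x0uniq x : B t x -> dotv c (f x - y) = 0 -> x = x0.
  move=> xt xE; have argmin z : dotv c (f z - y) = 0 ->
      forall x', B t x' -> dotv c (f z) <= dotv c (f x').
    move=> zE x' /cpos; rewrite -zE !dotvE; lra.
  by apply: (uniq t c) => //; [rewrite tgt0|exact: argmin|exact: argmin].
exists x0; first exact: incl.
(* Tilt c towards the defect d. On [Z], which excludes [x0], uniqueness makes c.(f x - y) strictly
   positive, so by compactness c + s d stays positive there for small s > 0. But the point that [tW]
   supplies for c + s d has d.(f x - y) <= 0 because c is tight, hence lies in [Z]. *)
apply: contrapT => x0y; pose d := f x0 - y.
have d0 : 0 < dotv d d by rewrite dotvv_gt0 subr_eq0; apply/eqP.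
pose Z := B t `&` [set x | dotv d (f x - y) <= 0].
have cfy : continuous (fun x => f x - y).
  by move=> x; apply: (cvgB (FF := nbhs_filter x)); [exact: cf|exact: cvg_cst].
have cd : continuous (fun _ : 'rV[R]_N => d) by exact: cst_continuous.
have cdf : continuous (fun x => dotv d (f x - y)) := continuous_dotv cd cfy.
have Zc : compact Z.
  apply: compact_closedI; first exact: compact_le_dotv.
  apply: (@closed_comp _ _ (fun x => dotv d (f x - y)) [set a | a <= 0]).
    by move=> x _; exact: cdf.
  exact: closed_le.
move: Zc => /compact_near_coveringP/(_ R (nbhs (0 : R))
  (fun s x => 0 < dotv (c + s *: d) (f x - y)) _).
case=> [x [xt xd]|e /= e0 He].
  apply: (near_dotv_gt0 (T := ('rV[R]_N * R)%type) (p := (x, 0 : R))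
    (g := fun p => c + p.2 *: d) (h := fun p => f p.1 - y)).
  - move=> p; apply: (cvgD (FF := nbhs_filter p)); first exact: cvg_cst.
    by apply: (cvgZr_tmp (FF := nbhs_filter p)); exact: cvg_snd.
  - move=> p; apply: (@continuous_comp _ _ _ (fun q : 'rV[R]_N * R => q.1)
      (fun x => f x - y)); [exact: cvg_fst|exact: cfy].
  - rewrite /= scale0r addr0 lt0r cpos// andbT; apply/eqP => /(x0uniq _ xt) xE.
    by move: xd; rewrite /= xE leNgt d0.
pose s := e / 2; have s0 : 0 < s by rewrite divr_gt0.
have /He{}He : ball_ [eta Num.norm] 0 e s.
  by rewrite /= sub0r normrN gtr0_norm// /s; lra.
(* Its dot product with c is 1, because c.d = 0. *)
have k0 : c + s *: d != 0.
  apply/eqP => /(congr1 (dotv c)); rewrite dotvDr dotvZr c1 x0E mulr0 addr0.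
  by rewrite dotvC dotv0l => /eqP; rewrite oner_eq0.
have [x xt] := tW _ (dotvv_unit k0); rewrite dotvZl pmulr_rle0; last first.
  by rewrite invr_gt0 sqrtr_gt0 dotvv_gt0.
move=> xle; have : Z x.
  split=> //=; rewrite -(pmulr_rle0 _ s0).
  by move: xle (cpos _ xt); rewrite dotvDl dotvZl; lra.
by move=> /He; rewrite ltNge xle.
Qed.

Lemma strictly_convex_image r : 0 <= r ->
  (forall t c x1 x2, 0 < t <= r -> dotv c c = 1 -> B t x1 -> B t x2 ->
    (forall x, B t x -> dotv c (f x1) <= dotv c (f x)) ->
    (forall x, B t x -> dotv c (f x2) <= dotv c (f x)) -> x1 = x2) ->
  strictly_convex (f @` B r).
Proof.
move=> r0 uniq; split.
- apply: continuous_compact; last exact: compact_le_dotv.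
  by apply: continuous_subspaceT; exact: cf.
- move=> _ _ l /set_mem[x1 x1r <-] /set_mem[x2 x2r <-]; apply/mem_set.
  apply: ball_image_surj => // c c1.
  have l0 : 0 <= l%:num by [].
  have l1 : l%:num <= 1 by [].
  rewrite -[conv _ _ _]/(l%:num *: f x1 + (1 - l%:num) *: f x2).
  move: (l%:num) l0 l1 => {}l l0 l1.
  (* In direction c the endpoint with the smaller value lies below the convex combination. *)
  have [le12|/ltW le21] := leP (dotv c (f x1)) (dotv c (f x2)).
    by exists x1 => //; rewrite !dotvE; nra.
  by exists x2 => //; rewrite !dotvE; nra.
- move=> c h [c0 hmin [_ [x0 x0r <-] x0h]]; exists (f x0); split.
    by split=> //; exists x0.
  move=> _ [[x xr <-] xh]; congr f.
  (* Uniqueness is assumed for positive radii; the ball of radius 0 is a single point. *)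
  have [rE|rn0] := eqVneq r 0.
    move: xr x0r; rewrite /B/= rE expr0n/= !le_eqVlt !ltNge !dotvv_ge0 !orbF.
    by rewrite !dotvv_eq0 => /eqP -> /eqP ->.
  have argmin z : dotv c (f z) = h -> forall x', B r x' ->
      dotv ((Num.sqrt (dotv c c))^-1 *: c) (f z)
      <= dotv ((Num.sqrt (dotv c c))^-1 *: c) (f x').
    move=> zh x' x'r; rewrite !dotvZl ler_pM2l; last first.
      by rewrite invr_gt0 sqrtr_gt0 dotvv_gt0.
    by rewrite zh; apply: hmin; exists x'.
  apply: (uniq r) (dotvv_unit c0) x0r xr (argmin _ x0h) (argmin _ xh).
  by rewrite lt0r rn0 r0 lexx.
Qed.

End ImageConvexity.

(** * Transport of the problem from K^n to real coordinates *)

Lemma det0_colP (F : fieldType) n (M : 'M[F]_n) :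
  reflect (exists2 x : 'cV[F]_n, x != 0 & M *m x = 0) (\det M == 0).
Proof.
rewrite -det_tr; apply: (iffP det0P) => -[x x0 xM]; exists x^T.
- by rewrite trmx_eq0.
- by rewrite -[M]trmxK -trmx_mul xM trmx0.
- by rewrite trmx_eq0.
- by rewrite -trmx_mul xM trmx0.
Qed.

Section RealCoordinates.
Variables (R : realType) (K : scalar_field R) (n N : nat).
(** An abstract real coordinate system, so that both scalar cases share one argument: [phi] sends
    columns to real rows, and [rho] sends a matrix to its action on these rows from the right. *)
Variables (phi : 'cV[K]_n -> 'rV[R]_N) (rho : 'M[K]_n -> 'M[R]_N).
Hypothesis N_gt0 : (0 < N)%N.
Hypothesis phiD : {morph phi : x y / x + y}.
Hypothesis phiZ : forall (a : R) x, phi (of_real K a *: x) = a *: phi x.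
Hypothesis phi_bij : bijective phi.
Hypothesis phiM : forall B x, phi (B *m x) = phi x *m rho B.
Hypothesis rho_tr : forall B, is_hermitian B -> (rho B)^T = rho B.
Hypothesis phi_sqnorm : forall x, sqnorm x = dotv (phi x) (phi x).
Hypothesis real_partB : {morph @real_part R K : a b / a - b}.
Hypothesis phi_adjoint : forall x y,
  real_part ((adjoint x *m y) 0 0) = dotv (phi x) (phi y).

Let phi0 : phi 0 = 0.
Proof. by apply: (addrI (phi 0)); rewrite -phiD !addr0. Qed.

Let phiN x : phi (- x) = - phi x.
Proof. by apply/eqP; rewrite -addr_eq0 -phiD addNr phi0. Qed.

Let phi_sum (I : finType) (F : I -> 'cV[K]_n) :
  phi (\sum_i F i) = \sum_i phi (F i).
Proof. exact: (big_morph _ phiD phi0). Qed.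

Let phi_eq0 x : (phi x == 0) = (x == 0).
Proof. by rewrite -phi0 (inj_eq (bij_inj phi_bij)). Qed.

Let phi_surj u : exists x, phi x = u.
Proof. by case: phi_bij => g _ gK; exists (g u). Qed.

Let phi_quad B u x :
  real_part ((adjoint x *m B *m x - adjoint u *m x - adjoint x *m u) 0 0)
  = quad (rho B) (phi u) (phi x).
Proof.
have entryB (X Y Z : 'M[K]_1) : (X - Y - Z) 0 0 = X 0 0 - Y 0 0 - Z 0 0.
  by rewrite !mxE.
rewrite entryB !real_partB -mulmxA.
by rewrite !phi_adjoint /quad phiM (dotvC (phi x) (phi u)) dotvC; ring.
Qed.

Let phi_res B (a e : R) x :
  phi ((B - (of_real K a)%:M + (of_real K e)%:M) *m x)
  = phi x *m (rho B - a%:M + e%:M).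
Proof.
by rewrite !mulmxDl mulNmx !mul_scalar_mx !phiD phiN !phiZ phiM
  !mulmxDr mulmxN !mul_mx_scalar.
Qed.

(** [eigenvalue] speaks of rows while [phi] acts on columns; the vanishing of det(B - a) links the
    two. *)
Lemma eigenvalue_realP B (a : R) :
  eigenvalue B (of_real K a) <->
  exists2 u : 'rV[R]_N, u != 0 & u *m rho B = a *: u.
Proof.
have -> : eigenvalue B (of_real K a) = (\det (B - (of_real K a)%:M) == 0).
  apply/eigenvalueP/det0P => -[w] wB w0; exists w => //.
    by rewrite mulmxBr mul_mx_scalar wB subrr.
  by apply: subr0_eq; rewrite -mul_mx_scalar -mulmxBr.
split=> [/det0_colP[x x0]|[u u0 uB]].
  rewrite mulmxBl mul_scalar_mx => /subr0_eq xB.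
  by exists (phi x); rewrite ?phi_eq0// -phiM xB phiZ.
have [x xu] := phi_surj u; apply/det0_colP; exists x.
  by rewrite -phi_eq0 xu.
rewrite mulmxBl mul_scalar_mx; apply/eqP; rewrite subr_eq0.
by rewrite -(inj_eq (bij_inj phi_bij)) phiM phiZ xu uB.
Qed.

(** The Rayleigh minimum of [rho B] is an eigenvalue and bounds all the others below, so it is the
    infimum defining [lambda_min]. *)
Lemma lambda_min_le B u : (rho B)^T = rho B ->
  lambda_min B * dotv u u <= dotv (u *m rho B) u.
Proof.
move=> Bsym; have [lam lamP [x x0 xB]] := rayleigh_min N_gt0 Bsym.
suff -> : lambda_min B = lam by exact: lamP.
have lamE : [set a : R | eigenvalue B (of_real K a)] lam.
  by apply/eigenvalue_realP; exists x.
have lam_lb : lbound [set a : R | eigenvalue B (of_real K a)] lam.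
  move=> a /eigenvalue_realP[z z0 zB]; have := lamP z.
  by rewrite zB dotvZl ler_pM2r ?dotvv_gt0.
apply/le_anti/andP; split; first by apply: ge_inf => //; exists lam.
by apply: lb_le_inf => //; exists lam.
Qed.

Section Family.
Variables (m : nat) (A : 'I_m -> 'M[K]_n) (v : 'I_m -> 'cV[K]_n).
Hypothesis A_herm : forall i, is_hermitian (A i).

Let S c := rho (comb_mx A c).
Let w c := phi (comb_vec v c).
Let lam c := lambda_min (comb_mx A c).

(** Linearity of [rho] is derived from that of [phi] by testing on basis vectors. *)
Let SE c : S c = \sum_i c 0 i *: rho (A i).
Proof.
apply/row_matrixP => i; rewrite !rowE; have [x <-] := phi_surj (delta_mx 0 i).
rewrite -phiM /comb_mx mulmx_suml phi_sum mulmx_sumr; apply: eq_bigr => j _.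
by rewrite -scalemxAl phiZ phiM scalemxAr.
Qed.

Let S_sym c : (S c)^T = S c.
Proof.
rewrite SE linear_sum; apply: eq_bigr => i _.
by rewrite linearZ/= rho_tr.
Qed.

Let S_psd c u : 0 <= dotv (u *m (S c - (lam c)%:M)) u.
Proof.
by rewrite mulmxBr mul_mx_scalar !dotvE subr_ge0; exact: (lambda_min_le _ (S_sym c)).
Qed.

Lemma dotv_quadratic_map c x :
  dotv c (quadratic_map A v x) = quad (S c) (w c) (phi x).
Proof.
rewrite /quad SE mulmx_sumr dotv_suml /w /comb_vec phi_sum dotv_suml.
rewrite mulr_sumr -sumrB; apply: eq_bigr => i _.
rewrite mxE phi_quad /quad -scalemxAr phiZ !dotvZl; ring.
Qed.

Let resolvent e c :=
  invmx (comb_mx A c - (of_real K (lam c))%:M + (of_real K e)%:M)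
  *m comb_vec v c.

Let resolventE (e : R) c : 0 < e ->
  phi (resolvent e c) *m (S c - (lam c)%:M + e%:M) = w c.
Proof.
move=> e0; rewrite -phi_res mulKVmx// unitmxE unitfE.
(* A kernel vector x would give 0 as the sum of a nonnegative term and e|x|^2 > 0. *)
apply/det0_colP => -[x x0 /(congr1 phi)]; rewrite phi_res phi0.
rewrite mulmxDr mul_mx_scalar => /(congr1 (fun u => dotv u (phi x))).
rewrite dotvDl dotvZl dotv0l => h; have := S_psd c (phi x).
have : 0 < e * dotv (phi x) (phi x) by rewrite mulr_gt0// dotvv_gt0 phi_eq0.
rewrite /S in h *; lra.
Qed.

(** Both resolvent vectors solve equations with right-hand side [w c], so the contraction applies to
    M + e1 with shift e2 - e1. *)
Lemma resolvent_sqnorm_le (e1 e2 : R) c : 0 < e1 <= e2 ->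
  resolvent_sqnorm A v e2 c <= resolvent_sqnorm A v e1 c.
Proof.
case/andP=> e10; rewrite le_eqVlt => /predU1P[->//|e12].
rewrite /resolvent_sqnorm !phi_sqnorm -/(resolvent e1 c) -/(resolvent e2 c).
have d0 : 0 < e2 - e1 by rewrite subr_gt0.
apply: (resolvent_contraction (S := S c - (lam c)%:M + e1%:M) _ d0) => [u|].
  rewrite mulmxDr dotvDl mul_mx_scalar dotvZl addr_ge0//.
  by rewrite mulr_ge0 ?dotvv_ge0// ltW.
rewrite resolventE// -(resolventE c (lt_trans e10 e12)).
rewrite -mul_mx_scalar -mulmxDr; congr (_ *m _).
by rewrite -addrA -raddfD/= [e1 + _]addrC subrK.
Qed.

(** By monotonicity the limit at 0+ is a supremum over e > 0, so a number below it lies below the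
    infimum over directions for a single e. *)
Lemma lt_eps_max_sq s : (s%:E < eps_max_sq A v)%E ->
  exists2 e : R, 0 < e & forall c, dotv c c = 1 -> lam c <= 0 ->
    s < resolvent_sqnorm A v e c.
Proof.
pose g e := ereal_inf [set (resolvent_sqnorm A v e c)%:E |
  c in nonpos_directions A].
have gcvg : g e @[e --> 0^'+] -->
    ereal_sup [set g e | e in [set` Interval (BRight 0) (BInfty R false)]].
  apply: nonincreasing_at_right_cvge => // e1 e2.
  rewrite !in_itv/= !andbT => e10 e20 e12; apply: le_ereal_inf_tmp => _ [c cC <-].
  apply: (@le_trans _ _ (resolvent_sqnorm A v e2 c)%:E).
    by apply: ereal_inf_lbound; exists c.
  by rewrite lee_fin resolvent_sqnorm_le// e10.
rewrite /eps_max_sq (cvg_lim _ gcvg)// => /ereal_sup_gt[_ [e e0 <-] sg].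
move: e0; rewrite /= in_itv/= andbT => e0; exists e => // c c1 c0.
by rewrite -lte_fin; apply: lt_le_trans sg _; apply: ereal_inf_lbound; exists c.
Qed.

Lemma quadratic_map_strictly_convex eps :
  ((eps ^+ 2)%:E <= eps_max_sq A v)%E ->
  strictly_convex (quadratic_map A v @` origin_ball K n eps).
Proof.
move=> epsP; case: (phi_bij) => psi phiK psiK.
pose f u := \row_i quad (rho (A i)) (phi (v i)) u.
have fE x : quadratic_map A v x = f (phi x).
  by apply/rowP => i; rewrite mxE [RHS]mxE phi_quad.
have -> : quadratic_map A v @` origin_ball K n eps
    (* The sign of [eps] is arbitrary, whereas [strictly_convex_image] takes a nonnegative
       radius. *)
    = f @` [set u | dotv u u <= `|eps| ^+ 2].
  rewrite real_normK ?num_real//; apply/seteqP; split=> _ [x /= xe <-].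
    by exists (phi x); rewrite //= -phi_sqnorm.
  by exists (psi x); rewrite /origin_ball/= ?phi_sqnorm ?fE psiK.
apply: strictly_convex_image; [|exact: normr_ge0|].
  have -> : f = fun u => \sum_i quad (rho (A i)) (phi (v i)) u *: delta_mx 0 i.
    apply/funext => u; rewrite [LHS]row_sum_delta.
    by apply: eq_bigr => i _; rewrite mxE.
  apply: continuous_big => [|i _ u]; first exact: add_continuous.
  apply: (cvgZr_tmp (FF := nbhs_filter u)).
  exact: continuous_quad.
move=> t c u1 u2 /andP[t0 te] c1 u1t u2t u1min u2min.
have dotE u : dotv c (f u) = quad (S c) (w c) u.
  by rewrite -[u]psiK -fE dotv_quadratic_map.
apply: (quad_ball_argmin_unique (w := w c) (S_sym c) _ t0 _ u1t u2t).
- by move=> z; exact: (lambda_min_le _ (S_sym c)).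
- move=> lam0 s st; have [|e e0 /(_ c c1 lam0) se] := @lt_eps_max_sq s.
    apply: lt_le_trans epsP; rewrite lte_fin; apply: lt_le_trans st _.
    by rewrite -(real_normK (num_real eps)) ler_pXn2r// nnegrE ltW.
  exists e, (phi (resolvent e c)); split=> //; last by rewrite -phi_sqnorm.
  by rewrite -(resolventE c e0) !mulmxDr mulmxN !mul_mx_scalar.
- by move=> u /u1min; rewrite !dotE.
- by move=> u /u2min; rewrite !dotE.
Qed.

End Family.
End RealCoordinates.

(** * Complex vectors and matrices as real ones of twice the size *)

Section ComplexCoordinates.
Variables (R : realType) (n : nat).

Definition re_mx p q (B : 'M[R[i]%C]_(p, q)) : 'M[R]_(p, q) :=
  map_mx (@complex.Re R) B.

Definition im_mx p q (B : 'M[R[i]%C]_(p, q)) : 'M[R]_(p, q) :=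
  map_mx (@complex.Im R) B.

Definition realify_vec (x : 'cV[R[i]%C]_n) : 'rV[R]_(n + n) :=
  row_mx (re_mx x)^T (im_mx x)^T.

(* The blocks are transposed because [realify_mx B] acts on row vectors. *)
Definition realify_mx (B : 'M[R[i]%C]_n) : 'M[R]_(n + n) :=
  block_mx (re_mx B)^T (im_mx B)^T (- (im_mx B)^T) (re_mx B)^T.

Lemma Re_sum (I : finType) (F : I -> R[i]%C) :
  complex.Re (\sum_i F i) = \sum_i complex.Re (F i).
Proof. by apply: (big_morph (@complex.Re R)) => // -[? ?] [? ?]. Qed.

Lemma Im_sum (I : finType) (F : I -> R[i]%C) :
  complex.Im (\sum_i F i) = \sum_i complex.Im (F i).
Proof. by apply: (big_morph (@complex.Im R)) => // -[? ?] [? ?]. Qed.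

Lemma re_mulmx p q r (B : 'M[R[i]%C]_(p, q)) (C : 'M[R[i]%C]_(q, r)) :
  re_mx (B *m C) = re_mx B *m re_mx C - im_mx B *m im_mx C.
Proof.
apply/matrixP => i j; rewrite !mxE Re_sum -sumrB; apply: eq_bigr => k _.
by rewrite !mxE; case: (B i k) => ? ?; case: (C k j) => ? ?.
Qed.

Lemma im_mulmx p q r (B : 'M[R[i]%C]_(p, q)) (C : 'M[R[i]%C]_(q, r)) :
  im_mx (B *m C) = re_mx B *m im_mx C + im_mx B *m re_mx C.
Proof.
apply/matrixP => i j; rewrite !mxE Im_sum -big_split; apply: eq_bigr => k _.
by rewrite !mxE; case: (B i k) => ? ?; case: (C k j) => ? ?.
Qed.

Lemma realify_vecM (B : 'M[R[i]%C]_n) x :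
  realify_vec (B *m x) = realify_vec x *m realify_mx B.
Proof.
rewrite /realify_vec /realify_mx re_mulmx im_mulmx mul_row_block.
by rewrite mulmxN linearB linearD/= !trmx_mul [in X in row_mx _ X]addrC.
Qed.

Lemma realify_vec_bij : bijective realify_vec.
Proof.
exists (fun u => \col_i Complex (lsubmx u 0 i) (rsubmx u 0 i)) => [x|u].
  apply/colP => i; rewrite mxE row_mxKl row_mxKr !mxE.
  by case: (x i 0).
rewrite /realify_vec -[RHS]hsubmxK.
by congr row_mx; apply/rowP => i; rewrite !mxE.
Qed.

(** Each summand is the real part of conj(x_i) y_i, so the dot product is the real part of the
    hermitian product. *)
Lemma dotv_realify x y : dotv (realify_vec x) (realify_vec y)
  = \sum_i (complex.Re (x i 0) * complex.Re (y i 0)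
            + complex.Im (x i 0) * complex.Im (y i 0)).
Proof.
rewrite /dotv big_split_ord/= -big_split; apply: eq_bigr => i _.
by rewrite /realify_vec !row_mxEl !row_mxEr !mxE.
Qed.

End ComplexCoordinates.

Theorem proposition2 (R : realType) (k : scalar_case) (m n : nat)
    (A : 'I_m -> 'M[scalars R k]_n) (v : 'I_m -> 'cV[scalars R k]_n)
    (eps : R) :
  (0 < m)%N -> (0 < n)%N ->
  (forall i, is_hermitian (A i)) ->
  ((eps ^+ 2)%:E <= eps_max_sq A v)%E ->
  strictly_convex (quadratic_map A v @` origin_ball (scalars R k) n eps).
Proof.
move=> _ n0; case: k A v => A v Ah epsP.
(* Over the reals the coordinates are obtained by transposition alone. *)
- apply: (@quadratic_map_strictly_convex R (scalars R RealScalars) n n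
    (fun x => x^T) (fun B => B^T)) => //.
  + by move=> x y; rewrite linearD.
  + by move=> a x; rewrite linearZ.
  + by exists (fun u => u^T) => x; rewrite trmxK.
  + by move=> B x; rewrite trmx_mul.
  + by move=> B; rewrite /is_hermitian /adjoint map_mx_id// => BE; rewrite !BE.
  + move=> x; apply: eq_bigr => i _.
    by rewrite /= !mxE real_normK ?num_real.
  + move=> x y; rewrite /= mxE; apply: eq_bigr => i _.
    by rewrite !mxE.
- apply: (quadratic_map_strictly_convex (K := scalars R ComplexScalars)
    (phi := @realify_vec R n) (rho := @realify_mx R n)) => //.
  + by rewrite addn_gt0 n0.
  + move=> x y; rewrite /realify_vec add_row_mx.
    by congr row_mx; apply/rowP => i; rewrite !mxE; case: (x i 0); case: (y i 0).
  + move=> a x; rewrite /realify_vec scale_row_mx.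
    by congr row_mx; apply/rowP => i; rewrite !mxE; case: (x i 0) => b c /=;
      rewrite mul0r ?subr0 ?addr0.
  + exact: realify_vec_bij.
  + exact: realify_vecM.
  (* A hermitian matrix has symmetric real part and antisymmetric imaginary part, which makes the
     block matrix symmetric. *)
  + move=> B Bh; rewrite /realify_mx tr_block_mx linearN/= !trmxK.
    have BE i j : B i j = conjc (B j i) by rewrite -[in LHS]Bh !mxE.
    have reT : (re_mx B)^T = re_mx B.
      by apply/matrixP => i j; rewrite !mxE (BE i j); case: (B j i).
    have imT : (im_mx B)^T = - im_mx B.
      by apply/matrixP => i j; rewrite !mxE (BE i j); case: (B j i) => ? ? /=;
        rewrite opprK.
    by rewrite reT imT opprK.
  + move=> x; rewrite dotv_realify; apply: eq_bigr => i _.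
    by rewrite [`|_|]normc_def/= sqr_sqrtr ?addr_ge0 ?sqr_ge0.
  + by case=> ? ? [].
  + move=> x y; rewrite dotv_realify mxE; apply: etrans (Re_sum _) _.
    apply: eq_bigr => i _.
    rewrite !mxE /=; case: (x i 0) => a b; case: (y i 0) => c d /=.
    by rewrite mulNr opprK.
Qed.
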